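(* Let $(M,g)$ be a $(q+r)$-dimensional Riemannian manifold, $\alpha$ a semi-calibration $q$-form on $M$, and $H$ a $q$-dimensional distribution on $M$ calibrated, thus oriented, by $\alpha$. Then for any $\pi\in G_H^+(q,M)$, $$\alpha_2|_\pi\le ve(\pi)\,\mathrm{vol}^H_\pi .$$ It follows that $\alpha_2$ is an anisotropic semi-calibration with respect to the function $$f:\mathcal U\to\mathbb R,\qquad f(\pi)=ve(\pi)\,\frac{\mathrm{vol}^H_\pi}{\mathrm{vol}_\pi},\qquad \mathcal U:=G_H^+(q,M),$$ i.e. $\alpha_2|_\pi\le f(\pi)\,\mathrm{vol}_\pi$ for all $\pi\in\mathcal U$.
   Context: $G(q,M)$ is the Grassmannian bundle of oriented $q$-planes in tangent spaces of $M$; for $\pi\in G(q,M)$, $\mathrm{vol}_\pi$ is the volume form on $\pi$ induced by its orientation and $g$. For top-degree forms on an oriented plane, $\lambda_1\mathrm{vol}_\pi\le\lambda_2\mathrm{vol}_\pi$ means $\lambda_1\le\lambda_2$. A $q$-form $\alpha$ is a semi-calibration if $\alpha|_\pi\le\mathrm{vol}_\pi$ for all $\pi\in G(q,M)$ (no closedness required). $H$ is calibrated by $\alpha$ if every $H_x$ carries an orientation with $\alpha|_{H_x}=\mathrm{vol}_{H_x}$; $H$ is given this orientation. Let $V=H^\perp$, so $TM=H\oplus V$, with projections $p_H,p_V$. Decompose $\alpha=\sum_{i=0}^q\alpha_i$ with $\alpha_i\in\Gamma(\Lambda^{q-i}H^*\otimes\Lambda^iV^* )$ (and $\alpha_i=0$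 for $i>q$). $G_H^+(q,M)$ is the set of $\pi\in G(q,M)$, $\pi\subseteq T_xM$, such that $p_H|_\pi:\pi\to H_x$ is an orientation-preserving isomorphism. For such $\pi$, $g^H_\pi:=(p_H|_\pi)^*g$ is the horizontal inner product on $\pi$, $\mathrm{vol}^H_\pi$ is the volume form on the oriented space $\pi$ defined by $g^H_\pi$, and $ve(\pi)=\frac12\big|p_V|_\pi\big|^2_{g^H_\pi\otimes g}$, i.e. $ve(\pi)=\frac12\sum_{i=1}^q|p_V(v_i)|_g^2$ for any orthonormal basis $\{v_i\}$ of $(\pi,g^H_\pi)$. *)

(* Defs.v *)
From HB Require Import structures.
From mathcomp Require Import all_boot all_order all_algebra.
From mathcomp Require Import all_classical all_reals all_analysis.

Set Implicit Arguments.
Unset Strict Implicit.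
Unset Printing Implicit Defensive.
Import Order.TTheory GRing.Theory Num.Theory.
Import numFieldNormedType.Exports.
Local Open Scope classical_set_scope.
Local Open Scope ring_scope.

Section LinearAlgebra.
Variables (R : realType) (q : nat) (T : vectType R).
Implicit Types (b : T -> T -> R) (P H V : {vspace T}) (w e : q.-tuple T).

Definition subst_tuple (i : 'I_q) (u : T) w : q.-tuple T :=
  [tuple if j == i then u else tnth w j | j < q].

Record altform := AltForm {
  altform_fun :> q.-tuple T -> R;
  altform_linear : forall i w a u v,
    altform_fun (subst_tuple i (a *: u + v) w) =
    a * altform_fun (subst_tuple i u w) + altform_fun (subst_tuple i v w);
  altform_alt : forall i j w,
    i != j -> tnth w i = tnth w j -> altform_fun w = 0 }.

(* An orientation is a sign (true = positive) for each ordered basis, two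
   bases having the same sign iff the change of basis has positive
   determinant.  Values outside the bases of P are irrelevant.  With this
   encoding a 0-dimensional space has its two orientations. *)
Record orientation P := Orientation {
  or_pos :> q.-tuple T -> bool;
  or_change : forall e e', basis_of P e -> basis_of P e' ->
    or_pos e' =
    (or_pos e == (0 < \det (\matrix_(i, j) coord e j (tnth e' i)))) }.

Record oplane := OPlane {
  plane :> {vspace T};
  plane_dim : \dim plane = q;
  plane_or : orientation plane }.

Definition orthonormal_basis b P e :=
  basis_of P e /\ forall i j : 'I_q, b (tnth e i) (tnth e j) = (i == j)%:R.

(* Only used in expressions that do not depend on the chosen basis. *)
Definition some_onb b P : q.-tuple T :=
  xget (nseq_tuple q 0) (orthonormal_basis b P).

(* The form on pi equal to 1 on the positive b-orthonormal bases of pi; only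
   its values on tuples of vectors of pi are meaningful. *)
Definition volform b (pi : oplane) w : R :=
  let e := some_onb b pi in
  (if plane_or pi e then 1 else -1) *
  \det (\matrix_(i, j) coord e j (tnth w i)).

Definition in_plane P w := forall i, tnth w i \in P.

Definition form_le b (pi : oplane) (omega eta : q.-tuple T -> R) :=
  exists l1 l2 : R,
  [/\ forall w, in_plane pi w -> omega w = l1 * volform b pi w,
      forall w, in_plane pi w -> eta w = l2 * volform b pi w
    & l1 <= l2].

(* the quotient omega / eta of two top-degree forms on pi, eta nonzero *)
Definition form_ratio (pi : oplane) (omega eta : q.-tuple T -> R) : R :=
  xget 0 [set l | forall w, in_plane pi w -> omega w = l * eta w].

Definition projH (g : {dot T for idfun}) H : 'End(T) :=
  daddv_pi H (orthov g H).

Definition projV (g : {dot T for idfun}) H : 'End(T) :=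
  daddv_pi (orthov g H) H.

Definition gH (g : {dot T for idfun}) H (u v : T) : R :=
  g (projH g H u) (projH g H v).

Definition vol_H (g : {dot T for idfun}) H (pi : oplane) : q.-tuple T -> R :=
  volform (gH g H) pi.

Definition ve (g : {dot T for idfun}) H (pi : oplane) : R :=
  let e := some_onb (gH g H) pi in
  2^-1 * \sum_(i < q) g (projV g H (tnth e i)) (projV g H (tnth e i)).

Definition in_GH_plus (g : {dot T for idfun}) H (oH : orientation H)
    (pi : oplane) :=
  [/\ (pi :&: lker (projH g H))%VS = 0%VS,
      (projH g H @: pi)%VS = H
    & forall e, basis_of pi e ->
        oH (map_tuple (projH g H) e) = plane_or pi e].

(* Lambda^(q-i) H^* (x) Lambda^i V^* inside Lambda^q T^*, where H^* (resp. V^* )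
   is the space of covectors vanishing on V (resp. H): the linear span of the
   theta_0 /\ ... /\ theta_(q-1) with the first q - i covectors in H^* and the
   last i in V^*; theta_0 /\ ... /\ theta_(q-1) sends w to
   det (theta_a (w_b)). *)
Definition in_bidegree H V (i : nat) (omega : altform) :=
  exists (N : nat) (c : 'I_N -> R) (theta : 'I_N -> 'I_q -> 'Hom(T, R^o)),
  (forall k (a : 'I_q), if (a < q - i)%N then (V <= lker (theta k a))%VS
                        else (H <= lker (theta k a))%VS) /\
  (forall w, omega w = \sum_(k < N)
     c k * \det (\matrix_(a, b) (theta k a (tnth w b) : R))).

End LinearAlgebra.

Section Smooth.
Variables (R : realType) (V W : normedModType R).

Fixpoint Ck_on (k : nat) (U : set V) (f : V -> W) : Prop :=
  if k is k'.+1 then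
    (forall x, U x -> differentiable f x) /\
    (forall v, Ck_on k' U (fun x => 'd f x v))
  else forall x, U x -> {for x, continuous f}.

(* meaningful for U open *)
Definition smooth_on (U : set V) (f : V -> W) := forall k, Ck_on k U f.

End Smooth.

Section Manifold.
Variables (R : realType) (n : nat) (M : topologicalType).

Record chart := Chart {
  chart_dom : set M;
  chart_cod : set 'rV[R]_n;
  chart_map :> M -> 'rV[R]_n;
  chart_inv : 'rV[R]_n -> M;
  chart_dom_open : open chart_dom;
  chart_cod_open : open chart_cod;
  chart_map_cod : forall x, chart_dom x -> chart_cod (chart_map x);
  chart_inv_dom : forall p, chart_cod p -> chart_dom (chart_inv p);
  chart_mapK : forall x, chart_dom x -> chart_inv (chart_map x) = x;
  chart_invK : forall p, chart_cod p -> chart_map (chart_inv p) = p;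
  chart_map_cont : forall x, chart_dom x -> {for x, continuous chart_map};
  chart_inv_cont : forall p, chart_cod p -> {for p, continuous chart_inv} }.

Record manifold := Manifold {
  atlas : set chart;
  (* a preferred chart around each point, used to coordinatize T_xM *)
  chart_at : M -> chart;
  chart_atP : forall x, atlas (chart_at x) /\ chart_dom (chart_at x) x;
  atlas_smooth : forall c d, atlas c -> atlas d ->
    smooth_on (c @` (chart_dom c `&` chart_dom d)) (d \o chart_inv c);
  manifold_hausdorff : hausdorff_space M;
  manifold_countable : @second_countable M }.

(* T_xM: a tangent vector is given by its components in the preferred chart
   at x; components in the other charts are obtained by the Jacobians of the
   transition maps (tangent_coord and its inverse tangent_vec). *)
Definition tangent (A : manifold) (x : M) : vectType R := 'rV[R]_n.

Variable A : manifold.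

Definition tangent_coord (c : chart) (x : M) (v : tangent A x) : 'rV[R]_n :=
  'd (c \o chart_inv (chart_at A x) : 'rV[R]_n -> 'rV[R]_n) (chart_at A x x) v.

Definition tangent_vec (c : chart) (x : M) (u : 'rV[R]_n) : tangent A x :=
  'd (chart_at A x \o chart_inv c : 'rV[R]_n -> 'rV[R]_n) (c x) u.

Definition smooth_vfield_on (U : set M) (X : forall x, tangent A x) :=
  forall c, atlas A c ->
    smooth_on (c @` (U `&` chart_dom c))
      (fun p => tangent_coord c (X (chart_inv c p))).

Record riemannian_metric := RiemannianMetric {
  metric_dot :> forall x, {dot tangent A x for idfun};
  metric_smooth : forall c, atlas A c -> forall u v : 'rV[R]_n,
    smooth_on (chart_cod c) (fun p => let x := chart_inv c p in
      metric_dot x (tangent_vec c x u) (tangent_vec c x v) : R^o) }.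

Variable q : nat.

Record qform := QForm {
  qform_at :> forall x, altform q (tangent A x);
  qform_smooth : forall c, atlas A c -> forall u : q.-tuple 'rV[R]_n,
    smooth_on (chart_cod c) (fun p => let x := chart_inv c p in
      qform_at x [tuple tangent_vec c x (tnth u i) | i < q] : R^o) }.

Record plane_distribution := PlaneDistribution {
  dist_at :> forall x, {vspace tangent A x};
  dist_dim : forall x, \dim (dist_at x) = q;
  dist_smooth : forall x, exists (U : set M) (X : 'I_q -> forall y, tangent A y),
    [/\ open U, U x, forall i, smooth_vfield_on U (X i)
      & forall y, U y -> basis_of (dist_at y) [tuple X i y | i < q]] }.

Definition dist_oplane (H : plane_distribution) (x : M) (o : orientation q (H x)) :
  oplane q (tangent A x) := OPlane (dist_dim H x) o.

Definition semi_calibration (g : riemannian_metric) (alpha : qform) :=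
  forall x (pi : oplane q (tangent A x)),
    form_le (g x) pi (alpha x) (volform (g x) pi).

(* only the values of f on U matter *)
Definition anisotropic_semi_calibration (g : riemannian_metric) (omega : qform)
    (U : forall x, set (oplane q (tangent A x)))
    (f : forall x, oplane q (tangent A x) -> R) :=
  forall x (pi : oplane q (tangent A x)), U x pi ->
    form_le (g x) pi (omega x) (fun w => f x pi * volform (g x) pi w).

Definition calibrated_by (g : riemannian_metric) (alpha : qform) (H : plane_distribution)
    (oH : forall x, orientation q (H x)) :=
  forall x w, in_plane (H x) w ->
    alpha x w = volform (g x) (dist_oplane (oH x)) w.

Definition decomposition (g : riemannian_metric) (H : plane_distribution) (alpha : qform)
    (alphas : nat -> qform) :=
  [/\ forall i x, (i <= q)%N ->
        in_bidegree (H x) (orthov (g x) (H x)) i (alphas i x),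
      forall i x w, (q < i)%N -> alphas i x w = 0
    & forall x w, alpha x w = \sum_(i < q.+1) alphas i x w].

Definition GH_plus (g : riemannian_metric) (H : plane_distribution)
    (oH : forall x, orientation q (H x)) (x : M) :
  set (oplane q (tangent A x)) := [set pi | in_GH_plus (g x) (oH x) pi].

Definition aniso_f (g : riemannian_metric) (H : plane_distribution) (x : M)
    (pi : oplane q (tangent A x)) : R :=
  ve (g x) (H x) pi *
  form_ratio pi (vol_H (g x) (H x) pi) (volform (g x) pi).

End Manifold.

(* Main.v *)
Require Import Defs.
From HB Require Import structures.
From mathcomp Require Import all_boot all_order all_algebra.
From mathcomp Require Import all_classical all_reals all_analysis.
From mathcomp Require Import ring lra.
Set Implicit Arguments.
Unset Strict Implicit.
Unset Printing Implicit Defensive.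
Import Order.TTheory GRing.Theory Num.Theory.
Import numFieldNormedType.Exports.
Local Open Scope classical_set_scope.
Local Open Scope ring_scope.

(** The inequality is a second order Taylor comparison at [H], made inside one
tangent space. Let [e] be a basis of [pi] that is orthonormal for the
horizontal inner product, and write [e_i = h_i + v_i] with [h_i] in [H] and
[v_i] in the orthogonal complement [V]; the [h_i] are an orthonormal basis of
[H]. Tilt [H] towards [pi] through the tuples [w_t = (h_i + t v_i)_i].

- By bidegree, [alpha (w_t) = sum_i t^i alpha_i (e)] ([alpha_tilt]), and at
  [t = 0] calibration gives [alpha_0 (e) = alpha (h) = 1] or [-1], according to
  the orientation of [e] ([alpha0_or_sign]).
- The Gram matrix of [w_t] is [1 + t^2 G], with [G] the Gram matrix of the
  [v_i], whose trace is [2 ve(pi)] ([gram_tilt]).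
- Applying the semi-calibration inequality to the span of [w_t] with each of its
  two orientations gives [alpha (w_t)^2 <= det (1 + t^2 G)]
  ([semi_calibration_sqr_le]). Squaring removes the square root from the volume
  and makes the choice of orientation immaterial.

Let [E(s)] be the even part of [t |-> alpha (w_t)], as a polynomial in
[s = t^2]. Averaging the bounds at [t] and [-t] gives [E(s)^2 <= det (1 + s G)]
for [s > 0], so the first order term drops out without having to be shown to
vanish. Both sides are polynomials in [s] equal to 1 at [s = 0]; comparing their
linear coefficients gives [2 alpha_0(e) alpha_2(e) <= tr G]
([quadratic_term_le]), that is [alpha_2 (e) <= ve(pi)] when [e] is positive.

Since [alpha_2], the horizontal volume form and the metric volume form are
proportional on [pi], the last two by a positive factor ([volform_ratio]), the
inequality between values at [e] is the inequality between forms, and dividing by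
the metric volume form gives the anisotropic semi-calibration. *)

(** * Expansions to first order *)

(** After division by the variable, the hypothesis says that a polynomial is
nonnegative on the positive half line, hence at 0 by continuity. *)
Lemma coef1_ge0 (R : realType) (p : {poly R}) :
  p`_0 = 0 -> (forall s, 0 < s -> 0 <= p.[s]) -> 0 <= p`_1.
Proof.
move=> p0 p_ge0.
have pE : p = drop_poly 1 p * 'X.
  rewrite -[LHS](poly_take_drop 1) expr1 [take_poly _ _]size1_polyC ?size_take_poly //.
  by rewrite coef_take_poly p0 add0r.
have -> : p`_1 = (drop_poly 1 p).[0] by rewrite horner_coef0 coef_drop_poly.
have dp_ge0 s : 0 < s -> 0 <= (drop_poly 1 p).[s].
  by move=> s0; move: (p_ge0 _ s0); rewrite {1}pE hornerM hornerX pmulr_lge0.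
set d := drop_poly 1 p in dp_ge0 *.
rewrite leNgt; apply/negP => d0.
have [e /= e0 near_d] := cvgr_lt _ (@continuous_horner _ d 0) _ d0.
have /near_d/= : ball_ Num.norm (0 : R) e (e / 2).
  by rewrite /ball_ /= sub0r normrN gtr0_norm ?divr_gt0 // ltr_pdivrMr // ltr_pMr // ltr1n.
by rewrite ltNge dp_ge0 // divr_gt0.
Qed.

(** The polynomial is the characteristic polynomial of [- G] with its
coefficients reversed, because [1 + s G = s (s^-1 + G)]. *)
Lemma det_pencil_poly (R : realType) (q : nat) (G : 'M[R]_q) :
  exists D : {poly R}, [/\ D`_0 = 1, D`_1 = \tr G
    & forall s, 0 < s -> D.[s] = \det (1%:M + s *: G)].
Proof.
pose c := char_poly (- G).
have size_c : size c = q.+1 by rewrite size_char_poly.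
exists (\poly_(i < q.+1) c`_(q - i)); split.
- rewrite coef_poly subn0.
  by have /monicP := char_poly_monic (- G); rewrite lead_coefE -/c size_c.
- rewrite coef_poly subn1 ltnS; case: ltnP => [q_gt0|].
    by rewrite /c char_poly_trace // linearN /= opprK.
  by rewrite leqn0 => /eqP q0; subst q; rewrite /mxtrace big_ord0.
move=> s s_gt0.
have -> : 1%:M + s *: G = s *: (s^-1%:M + G).
  by rewrite scalerDr scale_scalar_mx divff // gt_eqF.
have charE : c.[s^-1] = \det (s^-1%:M + G).
  rewrite /c /char_poly -horner_evalE -det_map_mx; congr (\det _).
  apply/matrixP => i j; rewrite !mxE rmorphB rmorphMn /= !horner_evalE.
  by rewrite hornerX hornerC opprK.
rewrite detZ -charE horner_poly horner_coef size_c mulr_sumr (reindex_inj rev_ord_inj) /=.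
apply: eq_bigr => i _; rewrite subSS subKn -1?ltnS // exprVn.
by rewrite mulrCA; congr (_ * _); rewrite expfB_cond // gt_eqF //= add0n -ltnS.
Qed.

(** The bounds at [t] and [- t] control the squares of [E + O t] and [E - O t],
where [E] and [O] are the even and odd parts of the sum evaluated at [t^2]; the
mean of these squares is at least [E^2]. The coefficient of [t^2] in [E^2] is
[2 a_0 a_2]. *)
Lemma quadratic_term_le (R : realType) (q n : nat) (G : 'M[R]_q) (a : nat -> R) :
    a 0%N ^+ 2 = 1 -> (forall i, (n < i)%N -> a i = 0) ->
    (forall t, (\sum_(i < n.+1) a i * t ^+ i) ^+ 2 <= \det (1%:M + t ^+ 2 *: G)) ->
  a 0%N * a 2%N <= 2^-1 * \tr G.
Proof.
move=> a0 a_gtn bound.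
have [D [D0 D1 DE]] := det_pencil_poly G.
pose p := \poly_(i < n.+1) a i.
have coef_p i : p`_i = a i by rewrite coef_poly ltnS; case: leqP => // /a_gtn.
pose E := even_poly p.
suff: 0 <= (D - E ^+ 2)`_1.
  rewrite coefB D1 expr2 coefM big_ord_recl big_ord1 /= !coef_even_poly !coef_p /=.
  lra.
apply: coef1_ge0 => [|s s_gt0].
  by rewrite coefB D0 expr2 coef0M coef_even_poly coef_p -expr2 a0 subrr.
rewrite !hornerE subr_ge0 DE //.
pose t := Num.sqrt s.
have tE : t ^+ 2 = s by rewrite sqr_sqrtr // ltW.
have pE u : u ^+ 2 = s -> p.[u] = E.[s] + (odd_poly p).[s] * u.
  by move=> us; rewrite -{1}(poly_even_odd p) !hornerE !horner_comp !hornerE us.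
move: (bound t) (bound (- t)); rewrite sqrrN tE -!horner_poly -/p.
rewrite (pE t) // (pE (- t)) ?sqrrN //.
set x := E.[s]; set y := (odd_poly p).[s] * t => le1 le2.
have : 0 <= y ^+ 2 by apply: sqr_ge0.
rewrite mulrN -/y in le2; nra.
Qed.

(** * Inner products *)

Section InnerProduct.
Variables (R : realType) (T : vectType R) (g : {dot T for idfun}).
Implicit Types (P H : {vspace T}).

Lemma dot_sym u v : g u v = g v u.
Proof. by rewrite hermC mul1r. Qed.

Lemma dot_eq0 u : g u u = 0 -> u = 0.
Proof.
by move=> gu0; apply: contra_eq gu0 => /(@neq0_dnorm_gt0 _ _ _ g)/lt0r_neq0.
Qed.

Lemma dotDZl u v w t : g (u + t *: v) w = g u w + t * g v w.
Proof. by rewrite linearDl /= linearZl_LR. Qed.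

Lemma dotDZ u v u' v' t : g (u + t *: v) (u' + t *: v') =
  g u u' + t * (g u v' + g v u') + t ^+ 2 * g v v'.
Proof.
rewrite linearDl !linearDr /= !linearZl_LR !linearZr_LR /=.
set a := g u u'; set b := g u v'; set c := g v u'; set d := g v v'.
by ring.
Qed.

Lemma dot_suml (I : Type) (s : seq I) (k : I -> R) (F : I -> T) v :
  g (\sum_(i <- s) k i *: F i) v = \sum_(i <- s) k i * g (F i) v.
Proof. by rewrite linear_sumlz; apply: eq_bigr => i _; rewrite linearZl_LR. Qed.

Lemma dot_sumr (I : Type) (s : seq I) (k : I -> R) (F : I -> T) v :
  g v (\sum_(i <- s) k i *: F i) = \sum_(i <- s) k i * g v (F i).
Proof. by rewrite dot_sym dot_suml; apply: eq_bigr => i _; rewrite dot_sym. Qed.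

(** A family that is biorthogonal to some other family is free. Besides
orthonormal families, this covers tilted bases of [H], which are biorthogonal to
the basis that they tilt. *)
Lemma dual_free (q : nat) (w h : q.-tuple T) :
  (forall i j, g (tnth w i) (tnth h j) = (i == j)%:R) -> free w.
Proof.
move=> dual; apply/freeP => k sum0 j.
have : g (\sum_i k i *: w`_i) (tnth h j) = 0 by rewrite sum0 linear0l.
rewrite dot_suml (bigD1 j) //= big1 ?addr0 => [|i ij]; last first.
  by rewrite -tnth_nth dual (negPf ij) mulr0.
by rewrite -tnth_nth dual eqxx mulr1.
Qed.

Lemma dual_basis_of (q : nat) P (w h : q.-tuple T) :
    \dim P = q -> in_plane P w ->
    (forall i j, g (tnth w i) (tnth h j) = (i == j)%:R) ->
  basis_of P w.
Proof.
move=> dimP wP /dual_free w_free; rewrite basisEfree w_free size_tuple dimP leqnn.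
by rewrite andbT; apply/span_subvP => _ /tnthP[i ->]; apply: wP.
Qed.

(** Gram-Schmidt: normalize a nonzero vector of [P] and recurse on its
orthogonal complement in [P]. *)
Lemma orthonormal_basis_ex (q : nat) P :
  \dim P = q -> exists e : q.-tuple T, orthonormal_basis g P e.
Proof.
elim: q P => [|q IHq] P dimP.
  exists [tuple]; split; last by case.
  by move/eqP: dimP; rewrite dimv_eq0 => /eqP ->; apply: nil_basis.
have P0 : P != 0%VS by rewrite -dimv_eq0 dimP.
pose u := (Num.sqrt (g (vpick P) (vpick P)))^-1 *: vpick P.
have pick_gt0 : 0 < g (vpick P) (vpick P) by rewrite neq0_dnorm_gt0 ?vpick0.
have uP : u \in P by rewrite memvZ ?memv_pick.
have guu : g u u = 1.
  by rewrite linearZl_LR linearZr_LR /= mulrA -invfM -expr2 sqr_sqrtr ?ltW // mulVf // gt_eqF.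
have [|e [/basis_mem eP e_orth]] := IHq (P :&: orthov g <[u]>)%VS.
  rewrite -eq_dim_orthov1 ?dimP //; apply/mem_orthovPn; exists u => //.
  by have := oner_neq0 R; rewrite -guu.
have eu i : g (tnth e i) u = 0.
  have := eP _ (mem_tnth i e); rewrite memv_cap => /andP[_].
  by rewrite mem_orthov1 => /eqP.
have orth (i j : 'I_q.+1) :
    g (tnth [tuple of u :: e] i) (tnth [tuple of u :: e] j) = (i == j)%:R.
  case: (unliftP ord0 i) => [i' ->|->]; case: (unliftP ord0 j) => [j' ->|->].
  - by rewrite !tnthS e_orth (inj_eq (@lift_inj _ _)).
  - by rewrite !tnthS tnth0 eu.
  - by rewrite !tnthS tnth0 dot_sym eu.
  - by rewrite !tnth0 guu.
exists [tuple of u :: e]; split=> //; apply: dual_basis_of orth => // i.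
case: (unliftP ord0 i) => [i' ->|->]; rewrite ?tnth0 ?tnthS //.
by have := eP _ (mem_tnth i' e); rewrite memv_cap => /andP[].
Qed.

Lemma some_onbP (q : nat) P : \dim P = q ->
  orthonormal_basis g P (some_onb q g P).
Proof. by move=> /orthonormal_basis_ex; apply: xgetPex. Qed.

Lemma orthov_cap P : (P :&: orthov g P = 0)%VS.
Proof.
apply/eqP; rewrite -subv0; apply/subvP => u; rewrite memv_cap => /andP[uP].
by move=> /mem_orthovP/(_ u uP)/dot_eq0 ->; rewrite mem0v.
Qed.

Lemma orthov_add P : (P + orthov g P = fullv)%VS.
Proof.
apply/eqP; rewrite eqEsubv subvf; apply/subvP => u _.
have [e [e_basis e_orth]] := orthonormal_basis_ex (erefl (\dim P)).
pose h := \sum_i g u (tnth e i) *: tnth e i.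
(* [h] is the orthogonal projection of [u] to [P]. *)
have -> : u = h + (u - h) by rewrite addrC subrK.
apply: memv_add.
  by apply: memv_suml => i _; rewrite memvZ // (basis_mem e_basis) ?mem_tnth.
suff orth v : v \in P -> g (u - h) v = 0 by apply/mem_orthovP.
move=> /(coord_basis e_basis) ->.
rewrite dot_sumr big1 // => j _.
rewrite -tnth_nth linearBl /= dot_suml (bigD1 j) //= big1 => [|i ij].
  by rewrite e_orth eqxx mulr1 addr0 subrr mulr0.
by rewrite e_orth (negPf ij) mulr0.
Qed.

Lemma projHP H u : projH g H u \in H.
Proof. exact: memv_pi. Qed.

Lemma projVP H u : projV g H u \in orthov g H.
Proof. exact: memv_pi. Qed.

Lemma projHV H u : projH g H u + projV g H u = u.
Proof. by rewrite daddv_pi_add ?orthov_cap // orthov_add memvf. Qed.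

Lemma dot_HV H u v : u \in H -> v \in orthov g H -> g u v = 0.
Proof. by move=> uH /mem_orthovP/(_ u uH); rewrite dot_sym. Qed.

Lemma dot_projHV H u v : g (projH g H u) (projV g H v) = 0.
Proof. by apply: dot_HV; [apply: projHP | apply: projVP]. Qed.

Lemma dot_projVH H u v : g (projV g H u) (projH g H v) = 0.
Proof. by rewrite dot_sym dot_projHV. Qed.

End InnerProduct.

(** * Changes of basis and volume forms *)

Lemma mulr_gt0_eq (R : realDomainType) (a b : R) :
  a != 0 -> b != 0 -> (0 < a * b) = ((0 < a) == (0 < b)).
Proof.
case: (ltgtP 0 a) => // [a_gt0|a_lt0] _ b_neq0; first by rewrite pmulr_rgt0.
by rewrite nmulr_rgt0 //; case: ltgtP b_neq0.
Qed.

Section Coordinates.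
Variables (R : realType) (q : nat) (T : vectType R).
Implicit Types (P H V : {vspace T}) (e w : q.-tuple T).

Definition coord_mx e w : 'M[R]_q := \matrix_(i, j) coord e j (tnth w i).

Lemma coord_mx_sum P e w i : basis_of P e -> in_plane P w ->
  tnth w i = \sum_j coord_mx e w i j *: tnth e j.
Proof.
move=> e_basis wP; rewrite {1}(coord_basis e_basis (wP i)).
by apply: eq_bigr => j _; rewrite [in RHS]mxE -tnth_nth.
Qed.

(** Vectors are rows here, so matrices compose from left to right. *)
Lemma coord_mxM P e e' w : basis_of P e -> in_plane P w ->
  coord_mx e' w = coord_mx e w *m coord_mx e' e.
Proof.
move=> e_basis wP; apply/matrixP => i j; rewrite !mxE.
rewrite {1}(coord_mx_sum i e_basis wP) linear_sum.
by apply: eq_bigr => k _; rewrite linearZ /= !mxE.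
Qed.

Lemma coord_mxx P e : basis_of P e -> coord_mx e e = 1%:M.
Proof.
move=> /basis_free e_free; apply/matrixP => i j.
by rewrite !mxE (tnth_nth 0) coord_free.
Qed.

Lemma basis_in_plane P e : basis_of P e -> in_plane P e.
Proof. by move=> e_basis i; apply: (basis_mem e_basis); apply: mem_tnth. Qed.

Lemma det_coord_mxK P e e' : basis_of P e -> basis_of P e' ->
  \det (coord_mx e e') * \det (coord_mx e' e) = 1.
Proof.
move=> e_basis e'_basis.
by rewrite -det_mulmx -(coord_mxM e' e_basis) ?(coord_mxx e'_basis) ?det1 //;
  apply: basis_in_plane.
Qed.

Lemma det_coord_mx_neq0 P e e' :
  basis_of P e -> basis_of P e' -> \det (coord_mx e e') != 0.
Proof.
move=> e_basis e'_basis; apply/eqP => det0.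
have := det_coord_mxK e_basis e'_basis.
by rewrite det0 mul0r => /eqP; rewrite eq_sym oner_eq0.
Qed.

Lemma gram_coord_mx (g : {dot T for idfun}) P e w :
    orthonormal_basis g P e -> in_plane P w ->
  \matrix_(i, j) g (tnth w i) (tnth w j) = coord_mx e w *m (coord_mx e w)^T.
Proof.
move=> [e_basis e_orth] wP; apply/matrixP => i j; rewrite [LHS]mxE [RHS]mxE.
rewrite {1}(coord_mx_sum i e_basis wP) dot_suml; apply: eq_bigr => k _.
rewrite (coord_mx_sum j e_basis wP) dot_sumr (bigD1 k) //= e_orth eqxx mulr1.
rewrite big1 ?addr0 ?mxE // => l lk.
by rewrite e_orth eq_sym (negPf lk) mulr0.
Qed.

Definition oppo P (o : orientation q P) : orientation q P.
Proof.
exists (fun e => ~~ o e) => e e' e_basis e'_basis.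
by rewrite (or_change o e_basis e'_basis); case: (o e); case: (0 < _).
Defined.

Definition basis_or P e (e_basis : basis_of P e) : orientation q P.
Proof.
exists (fun e' => 0 < \det (coord_mx e e')) => e1 e2 e1_basis e2_basis.
rewrite (coord_mxM e e1_basis (basis_in_plane e2_basis)) det_mulmx.
rewrite -/(coord_mx e1 e2).
by rewrite mulrC mulr_gt0_eq ?(det_coord_mx_neq0 (P := P)).
Defined.

End Coordinates.

Section Volume.
Variables (R : realType) (q : nat) (T : vectType R) (g : {dot T for idfun}).
Implicit Types (P H V : {vspace T}) (e w : q.-tuple T) (pi : oplane q T).

Definition or_sign pi e : R := if plane_or pi e then 1 else -1.

Lemma or_sign_sqr pi e : or_sign pi e ^+ 2 = 1.
Proof. by rewrite /or_sign; case: ifP; rewrite ?sqrrN expr1n. Qed.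

(** The product is the absolute value of the determinant. *)
Lemma or_sign_change pi e e' : basis_of pi e -> basis_of pi e' ->
  0 < or_sign pi e * or_sign pi e' * \det (coord_mx e e').
Proof.
move=> e_basis e'_basis; have := det_coord_mx_neq0 e_basis e'_basis.
rewrite /or_sign (or_change (plane_or pi) e_basis e'_basis) -/(coord_mx e e').
by case: (ltgtP 0 (\det _)) => // det_sgn _; case: (plane_or pi e) => /=; lra.
Qed.

Lemma volformE b pi w :
  volform b pi w = or_sign pi (some_onb q b pi) * \det (coord_mx (some_onb q b pi) w).
Proof. by []. Qed.

(** The square of the volume form is the Gram determinant, which depends neither
on the orientation nor on the chosen orthonormal basis. *)
Lemma volform_sqr pi w : in_plane pi w ->
  volform g pi w ^+ 2 = \det (\matrix_(i, j) g (tnth w i) (tnth w j)).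
Proof.
move=> wP; have onb := some_onbP g (plane_dim pi).
by rewrite volformE exprMn or_sign_sqr mul1r (gram_coord_mx onb wP) det_mulmx det_tr -expr2.
Qed.

(** The determinant of the passage from the chosen orthonormal basis to [e] is 1
or -1, since its square is the Gram determinant of [e]; its sign is the one by
which the orientation changes. *)
Lemma volform_onb pi e : orthonormal_basis g pi e -> volform g pi e = or_sign pi e.
Proof.
move=> [e_basis e_orth]; have [f_basis _] := some_onbP g (plane_dim pi).
have : volform g pi e ^+ 2 == 1.
  rewrite volform_sqr; last exact: basis_in_plane e_basis.
  rewrite (_ : \matrix_(i, j) _ = 1%:M) ?det1 //.
  by apply/matrixP => i j; rewrite !mxE e_orth.
have := or_sign_change f_basis e_basis.
rewrite mulrAC -volformE sqrf_eq1 => gt0 /orP[] /eqP volE; move: gt0.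
  by rewrite volE /or_sign; case: (plane_or pi e) => //; lra.
by rewrite volE /or_sign; case: (plane_or pi e) => //; lra.
Qed.

(** The factor is the absolute value of a change of basis determinant: both
volume forms are positive for the same orientation of [pi]. *)
Lemma volform_ratio b b' pi :
    basis_of pi (some_onb q b pi) -> basis_of pi (some_onb q b' pi) ->
  exists2 mu : R, 0 < mu &
    forall w, in_plane pi w -> volform b' pi w = mu * volform b pi w.
Proof.
set e := some_onb q b pi; set e' := some_onb q b' pi => e_basis e'_basis.
exists (or_sign pi e' * or_sign pi e * \det (coord_mx e' e)).
  exact: or_sign_change.
move=> w wP; rewrite !volformE -/e -/e' (coord_mxM e' e_basis wP) det_mulmx.
have := or_sign_sqr pi e; set s := or_sign pi e => s2.
rewrite [RHS](_ : _ = s ^+ 2 * (or_sign pi e' * (\det (coord_mx e w) * \det (coord_mx e' e)))).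
  by rewrite s2 mul1r.
by ring.
Qed.

(** One orientation of the span of [w] bounds [omega w] from above by the volume
of [w], the other bounds it from below by its opposite. *)
Lemma semi_calibration_sqr_le (omega : q.-tuple T -> R) :
    (forall pi, form_le g pi omega (volform g pi)) ->
    forall w, free w ->
  omega w ^+ 2 <= \det (\matrix_(i, j) g (tnth w i) (tnth w j)).
Proof.
move=> semi w w_free.
have w_basis : basis_of <<w>>%VS w by rewrite /basis_of eqxx.
have dimw : \dim <<w>>%VS = q by rewrite (size_basis w_basis).
pose pi := OPlane dimw (basis_or w_basis).
pose pi' := OPlane dimw (oppo (basis_or w_basis)).
have wP : in_plane pi w by apply: basis_in_plane w_basis.
have vol_oppo : volform g pi' w = - volform g pi w.
  by rewrite !volformE /or_sign /=; case: (0 < _); rewrite /= ?mulN1r ?mul1r ?opprK.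
rewrite -[leRHS](volform_sqr wP).
have [l1 [l2 [/(_ w wP) omegaE /(_ w wP) volE le12]]] := semi pi.
have [m1 [m2 [/(_ w wP) omegaE' /(_ w wP) volE' le_m12]]] := semi pi'.
rewrite vol_oppo in omegaE' volE'; set d := volform g pi w in omegaE volE omegaE' volE' *.
have [d0|d_neq0] := eqVneq d 0; first by rewrite omegaE d0 mulr0.
have l2E : l2 = 1 by apply: (mulIf d_neq0); rewrite -volE mul1r.
have m2E : m2 = 1 by apply: (mulIf d_neq0); move: volE'; lra.
have m1E : m1 = - l1 by apply: (mulIf d_neq0); move: omegaE'; lra.
rewrite omegaE exprMn ler_piMl ?sqr_ge0 //.
rewrite l2E in le12; rewrite m1E m2E in le_m12; nra.
Qed.

(** The quotient of two forms is a genuine quotient as soon as the forms are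
proportional, even if the denominator vanishes. *)
Lemma form_ratioE pi (omega eta : q.-tuple T -> R) l :
    (forall w, in_plane pi w -> omega w = l * eta w) ->
  forall w, in_plane pi w -> omega w = form_ratio pi omega eta * eta w.
Proof.
pose ratios := [set k | forall w, in_plane pi w -> omega w = k * eta w].
by move=> lE; apply: (@xgetPex _ 0 ratios); exists l.
Qed.

End Volume.

(** * Bidegrees *)

Section Bidegree.
Variables (R : realType) (q : nat) (T : vectType R).
Implicit Types (P H V : {vspace T}) (e w : q.-tuple T).

(** A combination of determinants [det (theta_a (w_b))] is a top-degree form on
[P] by multiplicativity of the determinant. *)
Lemma bidegree_coord H V P i (omega : altform q T) e w :
    in_bidegree H V i omega -> basis_of P e -> in_plane P w ->
  omega w = \det (coord_mx e w) * omega e.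
Proof.
move=> [N [c [theta [_ omegaE]]]] e_basis wP.
rewrite !omegaE mulr_sumr; apply: eq_bigr => k _; rewrite mulrCA; congr (_ * _).
rewrite -(det_tr (coord_mx e w)) mulrC -det_mulmx; congr (\det _).
apply/matrixP => a b; rewrite !mxE {1}(coord_mx_sum b e_basis wP) linear_sum.
by apply: eq_bigr => j _; rewrite linearZ /= !mxE mulrC.
Qed.

(** Scaling the [V] components by [t] multiplies by [t] the rows of
[theta_a (w_b)] whose covector vanishes on [H], and there are [i] of them; the
remaining covectors do not see the [V] components. *)
Lemma bidegree_scale H V i (omega : altform q T) (h v : 'I_q -> T) t :
    in_bidegree H V i omega -> (i <= q)%N ->
    (forall b, h b \in H) -> (forall b, v b \in V) ->
  omega [tuple h b + t *: v b | b < q] = t ^+ i * omega [tuple h b + v b | b < q].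
Proof.
move=> [N [c [theta [thetaP omegaE]]]] le_iq hH vV.
rewrite !omegaE mulr_sumr; apply: eq_bigr => k _; rewrite mulrCA; congr (_ * _).
(* [d] lists the factors acquired by the rows. *)
pose d := \row_(a < q) (if (a < q - i)%N then 1 else t).
have -> : t ^+ i = \det (diag_mx d).
  rewrite det_diag; under eq_bigr do rewrite mxE.
  rewrite -(big_mkord xpredT (fun a => if (a < q - i)%N then 1 else t)) /=.
  rewrite (big_cat_nat (leq0n (q - i)) (leq_subr i q)) /=.
  rewrite big_nat big1 => [|a /andP[_ ->] //]; rewrite mul1r.
  rewrite big_nat (eq_bigr (fun=> t)) /= => [|a /andP[le_a _]].
    by rewrite -big_nat prodr_const_nat subKn.
  by rewrite ltnNge le_a.
rewrite -det_mulmx; congr (\det _); apply/matrixP => a b.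
rewrite mul_diag_mx !mxE !tnth_mktuple !linearD linearZ /=.
have := thetaP k a; case: ifP => _ /subvP ker.
  have /ker := vV b; rewrite memv_ker => /eqP ->.
  by rewrite scaler0 mul1r.
have /ker := hH b; rewrite memv_ker => /eqP ->.
by rewrite !add0r.
Qed.

End Bidegree.

(** * The estimate at a point *)

Section Pointwise.
Variables (R : realType) (q : nat) (T : vectType R) (g : {dot T for idfun}).
Variables (H : {vspace T}) (dimH : \dim H = q) (oH : orientation q H).

(** At [t = 0] this is the projection of [e] to [H], at [t = 1] it is [e]
itself. *)
Definition tilt (e : q.-tuple T) (t : R) : q.-tuple T :=
  [tuple projH g H (tnth e i) + t *: projV g H (tnth e i) | i < q].

Lemma tilt1 e : tilt e 1 = e.
Proof. by apply: eq_from_tnth => i; rewrite tnth_mktuple scale1r projHV. Qed.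

(** The horizontal inner product is the pullback of [g] by an isomorphism onto
[H], so lifting an orthonormal basis of [H] gives an orthonormal basis. *)
Lemma some_onb_gHP (pi : oplane q T) : in_GH_plus g oH pi ->
  orthonormal_basis (gH g H) pi (some_onb q (gH g H) pi).
Proof.
move=> [_ imH _]; apply: xgetPex.
have [f [f_basis f_orth]] := orthonormal_basis_ex g dimH.
have [u uP] : exists u : 'I_q -> T, forall i, u i \in pi /\ projH g H (u i) = tnth f i.
  apply: (@fin_all_exists _ _ (fun i u => u \in pi /\ projH g H u = tnth f i)) => i.
  have : tnth f i \in (projH g H @: pi)%VS by rewrite imH; apply: (basis_in_plane f_basis).
  by move=> /memv_imgP[u u_pi ->]; exists u.
pose e := [tuple u i | i < q].
exists e; split => [|i j]; last by rewrite /gH !tnth_mktuple !(proj2 (uP _)).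
apply: (@dual_basis_of _ _ g _ _ _ f) => [|i|i j]; first exact: plane_dim.
  by rewrite tnth_mktuple; case: (uP i).
rewrite tnth_mktuple -[u i](projHV g H) linearDl /= (proj2 (uP i)) f_orth.
rewrite dot_sym (dot_HV (basis_in_plane f_basis j)) ?addr0 //.
exact: projVP.
Qed.

Lemma gram_tilt e t :
    (forall i j : 'I_q, gH g H (tnth e i) (tnth e j) = (i == j)%:R) ->
  \matrix_(i, j) g (tnth (tilt e t) i) (tnth (tilt e t) j) =
  1%:M + t ^+ 2 *: \matrix_(i, j) g (projV g H (tnth e i)) (projV g H (tnth e j)).
Proof.
move=> e_orth; apply/matrixP => i j; rewrite !mxE !tnth_mktuple.
have := e_orth i j; rewrite /gH => e_orth_ij.
by rewrite dotDZ dot_projHV dot_projVH e_orth_ij addr0 mulr0 addr0.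
Qed.

Lemma tilt_free e t :
    (forall i j : 'I_q, gH g H (tnth e i) (tnth e j) = (i == j)%:R) ->
  free (tilt e t).
Proof.
move=> e_orth; apply: (@dual_free _ _ g _ _ (map_tuple (projH g H) e)) => i j.
rewrite tnth_mktuple tnth_map dotDZl.
by rewrite dot_projVH mulr0 addr0; apply: e_orth.
Qed.

Variables (alpha : q.-tuple T -> R) (alphas : nat -> altform q T).
Hypothesis alpha_semi : forall P, form_le g P alpha (volform g P).
Hypothesis alpha_H :
  forall w, in_plane H w -> alpha w = volform g (OPlane dimH oH) w.
Hypothesis alphas_bidegree :
  forall i, (i <= q)%N -> in_bidegree H (orthov g H) i (alphas i).
Hypothesis alphas_gtq : forall i w, (q < i)%N -> alphas i w = 0.
Hypothesis alphaE : forall w, alpha w = \sum_(i < q.+1) alphas i w.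

Lemma alpha_tilt e t : alpha (tilt e t) = \sum_(i < q.+1) alphas i e * t ^+ i.
Proof.
rewrite alphaE; apply: eq_bigr => i _; have le_iq : (i <= q)%N by rewrite -ltnS.
rewrite mulrC -{2}(tilt1 e) (bidegree_scale t (alphas_bidegree le_iq)) //.
- by congr (_ * alphas i _); apply: eq_from_tnth => j; rewrite !tnth_mktuple scale1r.
- by move=> j; apply: projHP.
- by move=> j; apply: projVP.
Qed.

Variables (pi : oplane q T) (pi_plus : in_GH_plus g oH pi).
Local Notation e := (some_onb q (gH g H) pi).

(** At [t = 0] only [alpha_0] survives in the expansion of [alpha] along the
tilt, while calibration makes [alpha] the volume form of [H], evaluated at an
orthonormal basis of [H] oriented as [e] is. *)
Lemma alpha0_or_sign :
  alphas 0%N e = or_sign pi e.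
Proof.
have [e_basis e_orth] := some_onb_gHP pi_plus.
have [_ _ or_eq] := pi_plus.
have -> : alphas 0%N e = alpha (tilt e 0).
  rewrite alpha_tilt big_ord_recl expr0 mulr1 big1 ?addr0 // => i _.
  by rewrite expr0n mulr0.
have -> : tilt e 0 = map_tuple (projH g H) e.
  by apply: eq_from_tnth => i; rewrite tnth_mktuple tnth_map scale0r addr0.
have hH : in_plane H (map_tuple (projH g H) e) by move=> i; rewrite tnth_map projHP.
have h_orth (i j : 'I_q) : g (tnth (map_tuple (projH g H) e) i)
    (tnth (map_tuple (projH g H) e) j) = (i == j)%:R.
  by rewrite !tnth_map; apply: e_orth.
rewrite alpha_H // volform_onb; last by split=> //; apply: dual_basis_of h_orth.
by rewrite /or_sign /= or_eq.
Qed.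

(** The sign accounts for the fact that [e] may be a negative basis of [pi]. *)
Lemma alpha2_le_ve :
  or_sign pi e * alphas 2%N e <= ve g H pi.
Proof.
have [_ e_orth] := some_onb_gHP pi_plus.
pose G := \matrix_(i, j) g (projV g H (tnth e i)) (projV g H (tnth e j)).
have -> : ve g H pi = 2^-1 * \tr G.
  by congr (_ * _); apply: eq_bigr => i _; rewrite mxE.
rewrite -alpha0_or_sign; apply: (@quadratic_term_le _ _ q _ (fun i => alphas i e)).
- by rewrite alpha0_or_sign or_sign_sqr.
- by move=> i; apply: alphas_gtq.
move=> t; rewrite -alpha_tilt -gram_tilt //.
by apply: (semi_calibration_sqr_le alpha_semi); apply: tilt_free.
Qed.

Lemma vol_H_ratio : exists2 mu : R, 0 < mu &
  forall w, in_plane pi w -> vol_H g H pi w = mu * volform g pi w.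
Proof.
apply: volform_ratio; first by case: (some_onbP g (plane_dim pi)).
by case: (some_onb_gHP pi_plus).
Qed.

Lemma alpha2_vol_H :
  forall w, in_plane pi w ->
  alphas 2%N w = or_sign pi e * alphas 2%N e * vol_H g H pi w.
Proof.
move=> w wP; have [e_basis _] := some_onb_gHP pi_plus.
have [q_ge2|/alphas_gtq alpha2_0] := leqP 2 q; last by rewrite !alpha2_0 mulr0 mul0r.
rewrite (bidegree_coord (alphas_bidegree q_ge2) e_basis wP) /vol_H volformE.
by rewrite mulrACA -expr2 or_sign_sqr mul1r mulrC.
Qed.

Lemma alpha2_form_le :
  form_le g pi (alphas 2%N) (fun w => ve g H pi * vol_H g H pi w).
Proof.
have [mu mu_gt0 muE] := vol_H_ratio.
exists (or_sign pi e * alphas 2%N e * mu), (ve g H pi * mu); split.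
- by move=> w wP; rewrite alpha2_vol_H // muE // mulrA.
- by move=> w wP; rewrite muE // mulrA.
by rewrite ler_pM2r // alpha2_le_ve.
Qed.

End Pointwise.

Theorem theorem5p2 (R : realType) (q r : nat) (M : topologicalType)
    (A : manifold R (q + r) M) (g : riemannian_metric A)
    (alpha : qform A q) (H : plane_distribution A q)
    (oH : forall x, orientation q (H x)) (alphas : nat -> qform A q)
    (alpha_semi : semi_calibration g alpha)
    (alpha_H : calibrated_by g alpha oH)
    (alpha_dec : decomposition g H alpha alphas) :
  (forall x (pi : oplane q (tangent A x)), GH_plus g oH pi ->
     form_le (g x) pi (alphas 2%N x)
       (fun w => ve (g x) (H x) pi * vol_H (g x) (H x) pi w)) /\
  anisotropic_semi_calibration g (alphas 2%N) (GH_plus g oH) (aniso_f g H).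
Proof.
have [alphas_bidegree alphas_gtq alphaE] := alpha_dec.
have alpha2_le x (pi : oplane q (tangent A x)) : GH_plus g oH pi ->
    form_le (g x) pi (alphas 2%N x)
      (fun w => ve (g x) (H x) pi * vol_H (g x) (H x) pi w).
  move=> pi_plus.
  apply: (alpha2_form_le (alphas := fun i => alphas i x) (alpha_semi x)
    (@alpha_H x) _ _ (alphaE x)) => //.
  - by move=> i; apply: alphas_bidegree.
  - by move=> i w; apply: alphas_gtq.
split=> // x pi pi_plus; have [l1 [l2 [alpha2E veE le_l]]] := alpha2_le x pi pi_plus.
exists l1, l2; split=> // w wP; rewrite -veE // /aniso_f -mulrA; congr (_ * _).
have [mu _ muE] := vol_H_ratio (dist_dim H x) pi_plus.
by rewrite -(form_ratioE muE).
Qed.
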